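(* For every hypergraph $H$, \[ \mathsf{subw}^{\mathrm{lift}}(H)=\sup_{q\in \mathcal S(H)}\frac{\mathfrak B_H(q)}{\gamma_H^{\mathsf{Sub}}(q)}, \] with the convention that profiles $q$ with $\gamma_H^{\mathsf{Sub}}(q)=+\infty$ contribute ratio $0$ (and $0/0:=0$).
   Context: Hypergraphs $H=(V,E)$ are finite, with $E\subseteq 2^V$, and have no isolated vertices. For a set of sets $X$, $\bigcup X$ is the union of its members ($\bigcup\emptyset=\emptyset$). $\mathbf 1\text{-}\mathsf{Sub}(H)$ is the set of functions $b:2^V\to\mathbb R_{\ge0}$ that are normalised ($b(\emptyset)=0$), monotone, submodular ($b(X)+b(Y)\ge b(X\cup Y)+b(X\cap Y)$), and satisfy $b(X)\le 1$ for all $e\in E$, $X\subseteq e$. $\mathcal S(H)$ is the set of all $q:2^E\to\mathbb R_{\ge0}$ with $q(F)=q(E\setminus F)$ for all $F\subseteq E$. A branch decomposition of $E$ is a pair $(T,\delta)$ with $T$ a subcubic tree (all degrees $\le 3$) and $\delta$ a bijection from the leaves of $T$ onto $E$. Each $f\in E(T)$ induces a bipartition $(X_f,E\setminus X_f)$ of $E$ according to the two components of $T-f$. For $q\in\mathcal S(H)$ put $\mathfrak B_H(q):=\min_{(T,\delta)}\max_{f\in E(T)}q(X_f)$, with $\mathfrak B_H(q):=0$ if $|E|\le 1$. For $F\subseteq E$, $\partial_H(F):=(\bigcup F)\cap(\bigcup(E\setminus F))$; for $b:2^V\to\mathbb R_{\ge 0}$, $\lambda_b(F):=b(\partial_H(F))$.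 The lifted submodular width is $\mathsf{subw}^{\mathrm{lift}}(H):=\sup\{\mathfrak B_H(\lambda_b): b\in \mathbf 1\text{-}\mathsf{Sub}(H)\}$. The submodular realisable body is $K^{\mathsf{Sub}}_{\mathbf 1}(H):=\{q\in\mathbb R_{\ge0}^{2^E}: \exists b\in\mathbf 1\text{-}\mathsf{Sub}(H)\text{ with } q(F)\le\lambda_b(F)\ \forall F\subseteq E\}$, and the submodular gauge is $\gamma_H^{\mathsf{Sub}}(q):=\inf\{\alpha\ge0: q\in\alpha\cdot K^{\mathsf{Sub}}_{\mathbf 1}(H)\}$, with value $+\infty$ if no such $\alpha$ exists. *)

(* Defs.v *)
From mathcomp Require Import all_boot all_order all_algebra.
From mathcomp Require Import boolp classical_sets reals ereal.

Set Implicit Arguments.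
Unset Strict Implicit.
Unset Printing Implicit Defensive.

Import Order.TTheory GRing.Theory Num.Theory.
Local Open Scope ring_scope.

Record hypergraph (V : finType) := Hypergraph {
  hedges : {set {set V}};
  no_isolated : forall v : V, exists2 e, e \in hedges & v \in e }.

(* The elements of [E] as a finite type: [2^E] is [{set hedge H}] and
   [E \ F] is [~: F]. *)
Definition hedge (V : finType) (H : hypergraph V) := {e : {set V} | e \in hedges H}.

Section SubcubicTree.
Variables (T : finType) (adj : rel T).

Definition degree (x : T) : nat := #|[set y | adj x y]|.

Definition leaf := {x : T | degree x == 1%N}.

(* With [adj] symmetric, [[:: x; y]] is a [ucycle] for every edge xy; the
   genuine graph cycles are those of length at least 3. *)
Definition is_tree : Prop :=
  [/\ (0 < #|T|)%N, symmetric adj, irreflexive adj,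
      (forall x y, connect adj x y) &
      (forall c : seq T, ucycle adj c -> (size c <= 2)%N)].

Definition is_subcubic : Prop := forall x, (degree x <= 3)%N.

Definition remove_edge (x y : T) : rel T :=
  [rel a b | adj a b && ([set a; b] != [set x; y])].

End SubcubicTree.

Section BranchDecomposition.
Variable E : finType.

(* Trees matter only up to isomorphism, so the nodes are taken in ['I_n]. *)
Record branch_decomposition := BranchDecomposition {
  bd_size : nat;
  bd_adj : rel 'I_bd_size;
  bd_tree : is_tree bd_adj;
  bd_subcubic : is_subcubic bd_adj;
  bd_leaf : leaf bd_adj -> E;
  bd_leaf_bij : bijective bd_leaf }.

(* The side of the bipartition induced by the tree edge xy that belongs to the
   component of [x]; exchanging [x] and [y] gives the complementary side. *)
Definition bd_part (D : branch_decomposition) (x y : 'I_(bd_size D)) : {set E} :=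
  [set @bd_leaf D l | l : leaf (@bd_adj D) &
                        connect (remove_edge (@bd_adj D) x y) x (val l)].

Variable R : realType.

(* The maximum runs over both orientations of every tree edge, which is
   immaterial for symmetric [q]; so is the base value 0, as [q >= 0]. *)
Definition bd_width (q : {set E} -> R) (D : branch_decomposition) : R :=
  \big[Num.max/0]_(f : 'I_(bd_size D) * 'I_(bd_size D) | @bd_adj D f.1 f.2)
    q (bd_part f.1 f.2).

(* For 2 <= #|E| the widths form a nonempty set of values of [q] on the finite
   type [{set E}], so this infimum is a minimum. *)
Definition branch_min (q : {set E} -> R) : R :=
  if (#|E| <= 1)%N then 0 else inf (range (bd_width q)).

End BranchDecomposition.

Section SubmodularWidth.
Variables (R : realType) (V : finType) (H : hypergraph V).

Definition Sub1 : set ({set V} -> R) :=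
  [set b | [/\ (forall X, 0 <= b X),
               b finset.set0 = 0,
               (forall X Y : {set V}, X \subset Y -> b X <= b Y),
               (forall X Y : {set V}, b (X :|: Y) + b (X :&: Y) <= b X + b Y) &
               (forall e X : {set V}, e \in hedges H -> X \subset e -> b X <= 1)]]%classic.

Definition profiles : set ({set hedge H} -> R) :=
  [set q | (forall F, 0 <= q F) /\ (forall F, q F = q (~: F))]%classic.

Definition boundary (F : {set hedge H}) : {set V} :=
  (\bigcup_(e in F) val e) :&: (\bigcup_(e in ~: F) val e).

Definition lambda (b : {set V} -> R) (F : {set hedge H}) : R := b (boundary F).

Definition subw_lift : \bar R :=
  ereal_sup [set (branch_min (lambda b))%:E | b in Sub1]%classic.

Definition K_Sub1 : set ({set hedge H} -> R) :=
  [set q | (forall F, 0 <= q F) /\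
           exists2 b, Sub1 b & forall F, q F <= lambda b F]%classic.

Definition gauge_Sub (q : {set hedge H} -> R) : \bar R :=
  ereal_inf [set a%:E | a in
    [set a : R | 0 <= a /\ exists2 k, K_Sub1 k & q = (fun F => a * k F)]]%classic.

(* In [\bar R] one has [+oo^-1 = 0], [0^-1 = +oo] and [0 * +oo = 0]: a profile
   of infinite gauge has ratio 0, and [0 / 0 = 0]. *)
Definition gauge_ratio (q : {set hedge H} -> R) : \bar R :=
  ((branch_min q)%:E / gauge_Sub q)%E.

End SubmodularWidth.

(* Main.v *)
Require Import Defs.
From mathcomp Require Import all_boot all_order all_algebra.
From mathcomp Require Import boolp classical_sets reals ereal.

(** Monotonicity and homogeneity of [branch_min] give [branch_min q <= a * w]
    whenever [q] lies in the [a]-dilate of the body and [w] is the lifted width,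
    so every ratio is at most [w]; conversely each [lambda b] is a profile of
    gauge at most 1.  The one delicate case is gauge 0: there [w < +oo]
    (as [b X <= #|X|]) forces [branch_min q = 0], hence ratio 0. *)

Set Implicit Arguments.
Unset Strict Implicit.
Unset Printing Implicit Defensive.

Import Order.TTheory GRing.Theory Num.Theory.
Local Open Scope ring_scope.

Section BranchMin.
Variables (E : finType) (R : realType).
Implicit Types (q k : {set E} -> R) (D : branch_decomposition E).

Lemma bd_width_ge0 q D : 0 <= bd_width q D.
Proof. exact: bigmax_ge_id. Qed.

Lemma bd_width_le q D (c : R) :
  0 <= c -> (forall F, q F <= c) -> bd_width q D <= c.
Proof. by move=> c0 qc; apply/bigmax_leP; split. Qed.

Lemma bd_width_le_scale q k (a : R) D :
  0 <= a -> (forall F, q F <= a * k F) -> bd_width q D <= a * bd_width k D.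
Proof.
move=> a0 qk; apply/bigmax_leP; split; first by rewrite mulr_ge0 ?bd_width_ge0.
move=> f adjf; apply: (le_trans (qk _)); rewrite ler_wpM2l //.
exact: (@le_bigmax_cond _ _ _ _ f _ (fun f => k (bd_part f.1 f.2))).
Qed.

Lemma has_lbound_bd_width q : has_lbound (range (@bd_width E R q)).
Proof. by exists 0 => _ [D _ <-]; exact: bd_width_ge0. Qed.

Lemma inf_bd_width_le q D : inf (range (@bd_width E R q)) <= bd_width q D.
Proof. by apply: ge_inf; [exact: has_lbound_bd_width | exists D]. Qed.

(** Serves the case split on whether a branch decomposition exists: if none does, the infimum over
    the empty set takes its default value 0 ([inf0]), which agrees with the bounds below. *)
Lemma range_bd_width_eq0 q :
  ~ inhabited (branch_decomposition E) -> range (@bd_width E R q) = set0.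
Proof. by move=> noD; apply/seteqP; split=> // x [D]; case: noD. Qed.

Lemma branch_min_ge0 q : 0 <= branch_min q.
Proof.
rewrite /branch_min; case: ifP => // _.
have [[D]|noD] := pselect (inhabited (branch_decomposition E)).
  apply: lb_le_inf; first by exists (bd_width q D), D.
  by move=> _ [D' _ <-]; exact: bd_width_ge0.
by rewrite range_bd_width_eq0// inf0.
Qed.

Lemma branch_min_le q (c : R) :
  0 <= c -> (forall F, q F <= c) -> branch_min q <= c.
Proof.
move=> c0 qc; rewrite /branch_min; case: ifP => // _.
have [[D]|noD] := pselect (inhabited (branch_decomposition E)).
  exact: le_trans (inf_bd_width_le q D) (bd_width_le D c0 qc).
by rewrite range_bd_width_eq0// inf0.
Qed.

Lemma branch_min_le_scale q k (a : R) :
  0 <= a -> (forall F, q F <= a * k F) -> branch_min q <= a * branch_min k.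
Proof.
move=> a0 qk.
(* The main argument divides by [a]; for [a = 0] the hypothesis makes [q] nonpositive, so the bound
   0 applies. *)
have [aE|a_neq0] := eqVneq a 0.
  by rewrite aE mul0r; apply: branch_min_le => // F; have := qk F; rewrite aE mul0r.
have a_gt0 : 0 < a by rewrite lt0r a_neq0.
rewrite /branch_min; case: ifP => [_|_]; first by rewrite mulr0.
have [[D0]|noD] := pselect (inhabited (branch_decomposition E)); last first.
  by rewrite !range_bd_width_eq0// inf0 mulr0.
rewrite -ler_pdivrMl//; apply: lb_le_inf; first by exists (bd_width k D0), D0.
move=> _ [D _ <-]; rewrite ler_pdivrMl//.
exact: le_trans (inf_bd_width_le q D) (bd_width_le_scale D a0 qk).
Qed.

End BranchMin.

Section SubmodularGauge.
Variables (R : realType) (V : finType) (H : hypergraph V).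
Implicit Types (q : {set hedge H} -> R) (b : {set V} -> R).

Lemma Sub1_0 : Sub1 H (fun=> 0 : R).
Proof. by split=> // *; rewrite ?addr0. Qed.

(** Remove one vertex at a time: each lies in some edge, so its singleton has value at most 1, and
    submodularity with [b >= 0] gives subadditivity. *)
Lemma Sub1_le_card b (X : {set V}) : Sub1 H b -> b X <= #|X|%:R.
Proof.
move=> [b0 bset0 _ bsub b1].
move cardX : #|X| => n; elim: n X cardX => [|n IHn] X cardX.
  by rewrite (cards0_eq cardX) bset0.
have [v vX] : exists v, v \in X by apply/set0Pn; rewrite -card_gt0 cardX.
have [e eH ve] := no_isolated H v.
have cardXv : #|X :\ v| = n by move: cardX; rewrite (cardsD1 v) vX => -[].
have bv : b [set v]%SET <= 1 by apply: b1 eH _; rewrite finset.sub1set.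
rewrite -(finset.setD1K vX) -natr1 addrC.
apply: le_trans (lerD bv (IHn _ cardXv)).
by apply: le_trans (bsub _ _); rewrite lerDl.
Qed.

Lemma boundaryC (F : {set hedge H}) : boundary (~: F) = boundary F.
Proof. by rewrite /boundary finset.setCK finset.setIC. Qed.

Lemma lambda_profile b : Sub1 H b -> profiles (@lambda R V H b).
Proof. by move=> [b0 *]; split=> F; rewrite /lambda ?boundaryC. Qed.

Lemma gauge_Sub_ge0 q : (0 <= gauge_Sub q)%E.
Proof. by apply/ereal_infP => _ [a [a0 _] <-]; rewrite lee_fin. Qed.

Lemma gauge_lambda_le1 b : Sub1 H b -> (gauge_Sub (@lambda R V H b) <= 1)%E.
Proof.
move=> b_Sub1; apply: ereal_inf_lbound; exists 1 => //; split=> //.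
exists (lambda b); last by apply/funext => F; rewrite mul1r.
by case: (b_Sub1) => b0 *; split; [move=> F; exact: b0 | exists b].
Qed.

Lemma subw_lift_ge0 : (0 <= subw_lift R H)%E.
Proof.
(* The zero function shows that the supremum is not over the empty set, where it would be [-oo]. *)
apply: le_ereal_sup_tmp; exists (branch_min (@lambda R V H (fun=> 0)))%:E.
  by exists (fun=> 0) => //; exact: Sub1_0.
by rewrite lee_fin branch_min_ge0.
Qed.

Lemma subw_lift_fin_num : subw_lift R H \is a fin_num.
Proof.
rewrite ge0_fin_numE ?subw_lift_ge0//.
apply: (@le_lt_trans _ _ (#|V|%:R)%:E); last exact: ltry.
apply/ereal_supP => _ [b b_Sub1 <-]; rewrite lee_fin.
apply: branch_min_le => // F; apply: le_trans (Sub1_le_card _ b_Sub1) _.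
by rewrite ler_nat max_card.
Qed.

Lemma branch_min_le_dilate q (a : R) :
    0 <= a -> (exists2 k, K_Sub1 k & q = (fun F => a * k F)) ->
  ((branch_min q)%:E <= a%:E * subw_lift R H)%E.
Proof.
move=> a0 [k [_ [b b_Sub1 kb]] qE].
apply: (@le_trans _ _ (a%:E * (branch_min (@lambda R V H b))%:E)%E).
  by rewrite -EFinM lee_fin branch_min_le_scale// => F; rewrite qE ler_wpM2l.
by rewrite lee_wpmul2l ?lee_fin//; apply: ereal_sup_ubound; exists b.
Qed.

(** Takes the infimum over [a] in [branch_min_le_dilate], after dividing by the lifted width, which
    is finite. *)
Lemma branch_min_le_gauge q :
  (gauge_Sub q < +oo)%E ->
  ((branch_min q)%:E <= gauge_Sub q * subw_lift R H)%E.
Proof.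
move=> gauge_lty.
have subwE := fineK subw_lift_fin_num.
have : 0 <= fine (subw_lift R H) by rewrite fine_ge0 ?subw_lift_ge0.
rewrite le0r => /predU1P[w0|w_gt0].
  (* Width 0 rules out division, but a finite gauge supplies one admissible [a], and [a * 0 = 0]
     suffices. *)
  have /ereal_inf_ltP[_ [a [a0 aq] <-] _] := gauge_lty.
  by have := branch_min_le_dilate a0 aq; rewrite -subwE w0 !mule0.
rewrite -subwE -lee_pdivrMr//; apply/ereal_infP => _ [a [a0 aq] <-].
by rewrite lee_pdivrMr// subwE branch_min_le_dilate.
Qed.

Lemma gauge_ratio_le_subw_lift q : (gauge_ratio q <= subw_lift R H)%E.
Proof.
have := gauge_Sub_ge0 q; have := @branch_min_le_gauge q.
rewrite /gauge_ratio; case: (gauge_Sub q) => [g||] //.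
  move=> /(_ (ltry _)) Bg; rewrite lee_fin le0r => /predU1P[g0|g_gt0].
    (* Here the inverse of the gauge is [+oo], so the numerator must be shown to vanish exactly. *)
    move: Bg; rewrite g0 mul0e lee_fin => B0.
    have -> : branch_min q = 0 by apply/eqP; rewrite eq_le B0 branch_min_ge0.
    by rewrite mul0e subw_lift_ge0.
  by rewrite inver gt_eqF// lee_pdivrMr// muleC.
by move=> _ _; rewrite invey mule0 subw_lift_ge0.
Qed.

(** A gauge in [[0, 1]] has inverse at least 1, also at gauge 0, where the inverse is [+oo];
    dividing by it cannot decrease the nonnegative [branch_min]. *)
Lemma branch_min_le_gauge_ratio b :
  Sub1 H b -> ((branch_min (@lambda R V H b))%:E <= gauge_ratio (@lambda R V H b))%E.
Proof.
move=> b_Sub1.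
have g_ge0 := gauge_Sub_ge0 (@lambda R V H b).
rewrite -[leLHS]mule1 /gauge_ratio lee_wpmul2l ?lee_fin ?branch_min_ge0//.
by rewrite inve_ge1// gauge_lambda_le1.
Qed.

End SubmodularGauge.

Theorem theorem4p7 (R : realType) (V : finType) (H : hypergraph V) :
  subw_lift R H =
  ereal_sup [set gauge_ratio q | q in @profiles R V H]%classic.
Proof.
apply/eqP; rewrite eq_le; apply/andP; split; apply/ereal_supP => r [].
  move=> b b_Sub1 <-; apply: (le_trans (branch_min_le_gauge_ratio b_Sub1)).
  by apply: ereal_sup_ubound; exists (lambda b) => //; exact: lambda_profile.
by move=> q _ <-; exact: gauge_ratio_le_subw_lift.
Qed.
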